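(* Let $\nu>0$, $\lambda>0$, $\mu>0$, $\eta\in\mathbb{R}\setminus\{0\}$, $\delta=\lambda-\nu\mu$ with $\delta\ne0$, and let $m=2p+1$ with $p\in\mathbb{N}_0$. Let $F(V,t)=\nu V$ ($V\in\mathbb{R}$, $t>0$), $h(x)=\eta x^m$ and $\Phi(x)=-\mu\sin(\lambda x)$. Then the function $$u(x,t)=u_0(x,t)-\nu\Phi(x)\exp(-\lambda^2t)\int_0^tV(\tau)\exp(\lambda^2\tau)\,d\tau,\qquad x\ge 0,\ t\ge 0,$$ is a solution to Problem P, where $$u_0(x,t)=\frac{\eta}{\sqrt{\pi}}\sum_{k=0}^{p}\binom{m}{2k}\Gamma\!\left(\frac{2k+1}{2}\right)(4t)^kx^{m-2k},\qquad x\ge0,\ t\ge0,$$ and $V(t)=u_x(0,t)$ is given by $V(t)=p_{3,m}(t)+c_{3,m}\exp(-\lambda\delta t)$, $t>0$, with $c_{3,m}$ and $p_{3,m}$ as defined in the context.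
   Context: Problem P: $u_t(x,t)-u_{xx}(x,t)=-\Phi(x)F(u_x(0,t),t)$ for $x>0,t>0$; $u(x,0)=h(x)$ for $x>0$; $u(0,t)=0$ for $t>0$. With $m=2p+1$, put $c=\frac{2^{m-1}m\eta}{\sqrt\pi}\Gamma\left(\frac m2\right)$ ($\Gamma$ the Gamma function), $c_{3,m}=(-1)^{p-1}\dfrac{c\,\nu\mu\,p!}{\delta(\lambda\delta)^p}$, and $$p_{3,m}(t)=\begin{cases}\frac{\eta\lambda}{\delta} & \text{if }m=1,\\ c_{3,3}\big(\frac{\lambda^2\delta}{\nu\mu}t-1\big) & \text{if }m=3,\\ -c_{3,5}\big(\frac{\lambda^3\delta^2}{2\nu\mu}t^2-\lambda\delta t+1\big) & \text{if }m=5,\\ \frac{c\lambda}{\delta}t^p-c_{3,m}\Big(\sum_{k=1}^{p-1}\frac{(-\lambda\delta)^k}{k!}t^k+1\Big) & \text{if }m\ge 7.\end{cases}$$ *)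

(* Defs.v *)
From Stdlib Require Import Reals ZArith.
From Coquelicot Require Import Coquelicot.
Open Scope R_scope.

(* Euler's integral; the improper integral converges exactly for 0 < s. *)
Definition Gamma (s : R) : R :=
  RInt_gen (fun t => Rpower t (s - 1) * exp (- t))
           (at_right 0) (Rbar_locally p_infty).

Definition is_right_derive (f : R -> R) (x l : R) : Prop :=
  filterlim (fun y => (f y - f x) / (y - x)) (at_right x) (locally l).

Definition open_quadrant (z : R * R) : Prop := 0 < fst z /\ 0 < snd z.

(* The closed quadrant without its corner: the problem prescribes no value at
   (0, 0). *)
Definition closed_quadrant (z : R * R) : Prop :=
  0 <= fst z /\ 0 <= snd z /\ (0 < fst z \/ 0 < snd z).

(* Classical solutions of
     u_t - u_xx = - Phi(x) F(u_x(0,t), t)   for x > 0, t > 0,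
     u(x,0) = h(x)                          for x > 0,
     u(0,t) = 0                             for t > 0.
   Only the values of u on x >= 0, t >= 0 matter, so u_x(0,t), denoted by
   [ux0 t], is a right derivative.  Differentiability of [fun y => u y t] is
   required separately because [Derive] is total. *)
Definition solves_problem_P
    (Phi : R -> R) (F : R -> R -> R) (h : R -> R) (u : R -> R -> R) : Prop :=
  let u_t  := fun x t => Derive (fun s => u x s) t in
  let u_x  := fun x t => Derive (fun y => u y t) x in
  let u_xx := fun x t => Derive (fun y => u_x y t) x in
  exists ux0 : R -> R,
    (forall t, 0 < t -> is_right_derive (fun x => u x t) 0 (ux0 t)) /\
    (forall x t, 0 < x -> 0 < t ->
       ex_derive (fun s => u x s) t /\
       ex_derive (fun y => u y t) x /\
       ex_derive (fun y => u_x y t) x) /\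
    continuous_on closed_quadrant (fun z : R * R => u (fst z) (snd z)) /\
    continuous_on open_quadrant (fun z : R * R => u_t (fst z) (snd z)) /\
    continuous_on open_quadrant (fun z : R * R => u_x (fst z) (snd z)) /\
    continuous_on open_quadrant (fun z : R * R => u_xx (fst z) (snd z)) /\
    (forall x t, 0 < x -> 0 < t ->
       u_t x t - u_xx x t = - Phi x * F (ux0 t) t) /\
    (forall x, 0 < x -> u x 0 = h x) /\
    (forall t, 0 < t -> u 0 t = 0).

(* Below, the odd degree m is 2 * p + 1. *)

Definition c_const (eta : R) (p : nat) : R :=
  let m := (2 * p + 1)%nat in
  2 ^ (m - 1) * INR m * eta / sqrt PI * Gamma (INR m / 2).

(* The exponent p - 1 is an integer: it is -1 for p = 0. *)
Definition c3 (nu lambda mu eta : R) (p : nat) : R :=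
  let delta := lambda - nu * mu in
  powerRZ (-1) (Z.of_nat p - 1) *
  (c_const eta p * nu * mu * INR (fact p) / (delta * (lambda * delta) ^ p)).

Definition p3 (nu lambda mu eta : R) (p : nat) (t : R) : R :=
  let delta := lambda - nu * mu in
  let c := c_const eta p in
  let c3m := c3 nu lambda mu eta p in
  match p with
  | 0%nat => eta * lambda / delta
  | 1%nat => c3m * (lambda ^ 2 * delta / (nu * mu) * t - 1)
  | 2%nat =>
      - c3m * (lambda ^ 3 * delta ^ 2 / (2 * nu * mu) * t ^ 2
               - lambda * delta * t + 1)
  | _ =>
      c * lambda / delta * t ^ p
      - c3m * (sum_f 1 (p - 1)
                 (fun k => (- (lambda * delta)) ^ k / INR (fact k) * t ^ k) + 1)
  end.

Definition V (nu lambda mu eta : R) (p : nat) (t : R) : R :=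
  let delta := lambda - nu * mu in
  p3 nu lambda mu eta p t
  + c3 nu lambda mu eta p * exp (- (lambda * delta * t)).

Definition u0 (eta : R) (p : nat) (x t : R) : R :=
  let m := (2 * p + 1)%nat in
  eta / sqrt PI *
  sum_f_R0 (fun k => Binomial.C m (2 * k) * Gamma ((2 * INR k + 1) / 2)
                     * (4 * t) ^ k * x ^ (m - 2 * k)) p.

Definition u_sol (nu lambda mu eta : R) (p : nat) (Phi : R -> R)
    (x t : R) : R :=
  u0 eta p x t
  - nu * Phi x * exp (- (lambda ^ 2 * t))
    * RInt (fun tau => V nu lambda mu eta p tau * exp (lambda ^ 2 * tau)) 0 t.

(* Main.v *)
Require Import Defs.
From Stdlib Require Import Reals ZArith Arith Lra Lia.
From Coquelicot Require Import Coquelicot.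
Open Scope R_scope.

(** [u_0] solves the heat equation because of the recursion
    [C(m,2k+2) Gamma(k+3/2) 4 (k+1) = C(m,2k) Gamma(k+1/2) (m-2k) (m-2k-1)],
    and its slope at [x = 0] is [c t^p].  The correction
    [q(t) sin (lambda x)], with
    [q(t) = nu mu e^(-lambda^2 t) int_0^t V e^(lambda^2 tau) dtau], produces
    the source term because [q' = - lambda^2 q + nu mu V].  It remains to see
    that [V] is the slope of [u], i.e. that [V = c t^p + lambda q].  The four cases
    of [p_{3,m}] all give
    [V = (c lambda / delta) t^p + c_3 (e^z - sum_{k<p} z^k / k!)] with
    [z = - lambda delta t], so
    [V' + lambda delta V = c p t^(p-1) + lambda^2 c t^p] and [V(0) = c 0^p],
    which is the differentiated form of that integral equation. *)

(** * The Gaussian integral *)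

Definition gauss_int (x : R) : R := RInt (fun y => exp (- y ^ 2)) 0 x.

Lemma ex_RInt_everywhere_derivable (f : R -> R) :
  (forall x, ex_derive f x) -> forall a b, ex_RInt f a b.
Proof.
intros Hf a b; apply (ex_RInt_continuous (V := R_CompleteNormedModule)).
intros z _; apply (ex_derive_continuous (V := R_NormedModule)), Hf.
Qed.

Lemma is_derive_RInt_upper (f : R -> R) :
  (forall x, ex_derive f x) ->
  forall x, is_derive (fun x => RInt f 0 x) x (f x).
Proof.
intros Hf x; apply (is_derive_RInt f _ 0 x).
- apply filter_forall; intros y.
  apply (RInt_correct f), ex_RInt_everywhere_derivable, Hf.
- apply (ex_derive_continuous (V := R_NormedModule)), Hf.
Qed.

Lemma gauss_int_0 : gauss_int 0 = 0.
Proof. unfold gauss_int; rewrite RInt_point; reflexivity. Qed.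

Lemma is_derive_gauss_int (x : R) : is_derive gauss_int x (exp (- x ^ 2)).
Proof.
apply (is_derive_RInt_upper (fun y => exp (- y ^ 2))).
intros y; auto_derive; trivial.
Qed.

(* The square of [gauss_int] plus the integral of [gauss_param] over [0, 1] is
   constant, which evaluates the Gaussian integral. *)
Definition gauss_param (x s : R) : R :=
  exp (- (x ^ 2 * (1 + s ^ 2))) / (1 + s ^ 2).

Lemma exp_le_mono (x y : R) : x <= y -> exp x <= exp y.
Proof.
intros [H| ->]; [now apply Rlt_le, exp_increasing|apply Rle_refl].
Qed.

Lemma gauss_den_pos (s : R) : 0 < 1 + s ^ 2.
Proof. nra. Qed.

Lemma is_derive_gauss_param (x s : R) :
  is_derive (fun x => gauss_param x s) x
    (- 2 * x * exp (- (x ^ 2 * (1 + s ^ 2)))).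
Proof.
unfold gauss_param; pose proof (gauss_den_pos s).
auto_derive; [trivial|].
simpl; field; simpl in *; lra.
Qed.

Lemma ex_RInt_gauss_param (x a b : R) : ex_RInt (gauss_param x) a b.
Proof.
apply ex_RInt_everywhere_derivable; intros s; unfold gauss_param.
pose proof (gauss_den_pos s).
auto_derive; simpl in *; lra.
Qed.

(** Differentiation under the integral sign cancels the denominator [1 + s^2], and the substitution
    [y = x s] turns what is left into [gauss_int x]. *)
Lemma is_derive_RInt_gauss_param (x : R) :
  is_derive (fun x => RInt (gauss_param x) 0 1) x
    (- 2 * exp (- x ^ 2) * gauss_int x).
Proof.
replace (- 2 * exp (- x ^ 2) * gauss_int x)
  with (RInt (fun s => Derive (fun z => gauss_param z s) x) 0 1).
- apply (is_derive_RInt_param gauss_param).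
  + apply filter_forall; intros z s _.
    eexists; apply is_derive_gauss_param.
  + intros s _.
    apply continuity_2d_pt_ext
      with (fun u v => - 2 * u * exp (- (u ^ 2 * (1 + v ^ 2)))).
    * intros u v; symmetry; apply is_derive_unique, is_derive_gauss_param.
    * apply continuity_2d_pt_mult.
      -- apply continuity_2d_pt_mult;
           [apply continuity_2d_pt_const|apply continuity_2d_pt_id1].
      -- apply (continuity_1d_2d_pt_comp exp).
         ++ apply derivable_continuous_pt, derivable_pt_exp.
         ++ apply continuity_2d_pt_opp, continuity_2d_pt_mult.
            ** apply (continuity_1d_2d_pt_comp (fun y => y ^ 2) (fun u _ => u));
                 [reg|apply continuity_2d_pt_id1].
            ** apply (continuity_1d_2d_pt_comp (fun y => 1 + y ^ 2) (fun _ v => v));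
                 [reg|apply continuity_2d_pt_id2].
  + apply filter_forall; intros y; apply ex_RInt_gauss_param.
(* The exponential splits into a factor free of [s] and [exp (- (x s)^2)]; the inner [scal x] and
   the [+ 0] give the shape of a linear substitution. *)
- rewrite (RInt_ext _ (fun s => scal (- 2 * exp (- x ^ 2))
             (scal x (exp (- (x * s + 0) ^ 2))))).
  2:{ intros s _; transitivity (- 2 * x * exp (- (x ^ 2 * (1 + s ^ 2))));
        [apply is_derive_unique, is_derive_gauss_param|].
      replace (- (x ^ 2 * (1 + s ^ 2))) with (- x ^ 2 + - (x * s + 0) ^ 2)
        by ring.
      rewrite exp_plus; unfold scal; simpl; unfold mult; simpl; ring. }
  assert (Hex : forall a b, ex_RInt (fun y => exp (- y ^ 2)) a b).
  { apply ex_RInt_everywhere_derivable; intros y; auto_derive; trivial. }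
  rewrite (RInt_scal (V := R_CompleteNormedModule)).
  + rewrite (RInt_comp_lin (fun y => exp (- y ^ 2))) by apply Hex.
    unfold scal; simpl; unfold mult; simpl; unfold gauss_int.
    f_equal; f_equal; ring.
  + apply (ex_RInt_comp_lin (fun y => exp (- y ^ 2))), Hex.
Qed.

(** The two derivatives cancel, so the value is the one at [0], where the integrand is
    [1 / (1 + s^2)] with primitive [atan]. *)
Lemma gauss_int_sqr (x : R) :
  0 < x -> gauss_int x ^ 2 + RInt (gauss_param x) 0 1 = PI / 4.
Proof.
intros Hx.
transitivity (gauss_int 0 ^ 2 + RInt (gauss_param 0) 0 1).
- symmetry.
  apply (eq_is_derive (fun x => gauss_int x ^ 2 + RInt (gauss_param x) 0 1));
    [|exact Hx].
  intros t _.
  replace (@zero R_NormedModule)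
    with (plus (INR 2 * exp (- t ^ 2) * gauss_int t ^ 1)
               (- 2 * exp (- t ^ 2) * gauss_int t))
    by (unfold plus, zero; simpl; ring).
  apply (is_derive_plus (fun x => gauss_int x ^ 2)).
  + apply (is_derive_pow gauss_int 2), is_derive_gauss_int.
  + apply is_derive_RInt_gauss_param.
- rewrite gauss_int_0.
  rewrite (is_RInt_unique (gauss_param 0) 0 1 (minus (atan 1) (atan 0))).
  + rewrite atan_1, atan_0; unfold minus, plus, opp; simpl; field.
  + apply (is_RInt_ext (fun s => / (1 + s ^ 2))).
    { intros s _; unfold gauss_param.
      replace (- (0 ^ 2 * (1 + s ^ 2))) with 0 by ring.
      rewrite exp_0; symmetry; apply Rmult_1_l. }
    apply (is_RInt_derive atan).
    * intros s _; apply is_derive_Reals.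
      apply derivable_pt_lim_atan.
    * intros s _; apply (ex_derive_continuous (V := R_NormedModule)).
      pose proof (gauss_den_pos s); auto_derive; simpl in *; lra.
Qed.

(** One Taylor term suffices: [exp t >= t^(n+1) / (n+1)!] bounds the product by [(n+1)! / t]. *)
Lemma is_lim_pow_exp_neg (n : nat) :
  is_lim (fun t => t ^ n * exp (- t)) p_infty 0.
Proof.
apply (is_lim_le_le_loc (fun _ => 0) (fun t => INR (fact (S n)) * / t)).
- exists 0; intros t Ht.
  assert (Hp : 0 < t ^ n) by now apply pow_lt.
  assert (He : 0 < exp (- t)) by apply exp_pos.
  split; [now apply Rlt_le, Rmult_lt_0_compat|].
  assert (Hf : 0 < INR (fact (S n))) by apply INR_fact_lt_0.
  assert (H : t ^ S n / INR (fact (S n)) <= exp t).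
  { apply Rle_trans with (sum_f_R0 (fun k => t ^ k / INR (fact k)) (S n));
      [|apply exp_ge_taylor; lra].
    change (sum_f_R0 (fun k => t ^ k / INR (fact k)) (S n))
      with (sum_f_R0 (fun k => t ^ k / INR (fact k)) n
            + t ^ S n / INR (fact (S n))).
    assert (0 <= sum_f_R0 (fun k => t ^ k / INR (fact k)) n); [|lra].
    apply cond_pos_sum; intros k; apply Rlt_le, Rdiv_lt_0_compat;
      [now apply pow_lt|apply INR_fact_lt_0]. }
  apply Rmult_le_reg_r with (exp t); [apply exp_pos|].
  rewrite Rmult_assoc, <- exp_plus.
  replace (- t + t) with 0 by ring; rewrite exp_0, Rmult_1_r.
  apply Rmult_le_reg_l with (t / INR (fact (S n)));
    [now apply Rdiv_lt_0_compat|].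
  replace (t / INR (fact (S n)) * t ^ n) with (t ^ S n / INR (fact (S n)))
    by (simpl; unfold Rdiv; ring).
  replace (t / INR (fact (S n)) * (INR (fact (S n)) * / t * exp t))
    with (exp t) by (field; split; lra).
  exact H.
- apply is_lim_const.
- replace (Finite 0) with (Rbar_mult (INR (fact (S n))) (Rbar_inv p_infty))
    by (simpl; f_equal; ring).
  apply (is_lim_scal_l (fun t => / t)).
  apply is_lim_inv; [apply is_lim_id|easy].
Qed.

Lemma is_lim_exp_neg : is_lim (fun t => exp (- t)) p_infty 0.
Proof.
apply (is_lim_ext (fun t => t ^ 0 * exp (- t)));
  [intros t; simpl; ring|apply is_lim_pow_exp_neg].
Qed.

(** For [x > 1] the integrand [gauss_param x] is at most [exp (- x)], so its integral tends to [0]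
    and the square of [gauss_int] to [PI / 4]. The root can be taken because [gauss_int] is
    nonnegative for [x > 0]. *)
Lemma is_lim_gauss_int : is_lim gauss_int p_infty (sqrt PI / 2).
Proof.
assert (Hsq : is_lim (fun x => gauss_int x ^ 2) p_infty (PI / 4)).
{ apply (is_lim_ext_loc (fun x => PI / 4 - RInt (gauss_param x) 0 1)).
  { exists 0; intros x Hx; rewrite <- (gauss_int_sqr x Hx); ring. }
  replace (Finite (PI / 4)) with (Rbar_minus (PI / 4) 0)
    by (simpl; f_equal; ring).
  apply is_lim_minus'; [apply is_lim_const|].
  apply (is_lim_le_le_loc (fun _ => 0) (fun x => exp (- x)));
    [|apply is_lim_const|apply is_lim_exp_neg].
  exists 1; intros x Hx; split.
  - apply RInt_ge_0; [lra|apply ex_RInt_gauss_param|].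
    intros s _; apply Rlt_le, Rdiv_lt_0_compat;
      [apply exp_pos|apply gauss_den_pos].
  - apply Rle_trans with (RInt (fun _ => exp (- x)) 0 1).
    + apply RInt_le; [lra|apply ex_RInt_gauss_param|apply ex_RInt_const|].
      intros s _; unfold gauss_param.
      assert (exp (- (x ^ 2 * (1 + s ^ 2))) <= exp (- x)).
      { apply exp_le_mono; nra. }
      pose proof (exp_pos (- x)).
      apply Rle_div_l; [apply gauss_den_pos|nra].
    + rewrite RInt_const; unfold scal; simpl; unfold mult; simpl; lra. }
apply (is_lim_ext_loc (fun x => sqrt (gauss_int x ^ 2))).
{ exists 0; intros x Hx; apply sqrt_pow2.
  apply RInt_ge_0; [lra| |intros y _; apply Rlt_le, exp_pos].
  apply ex_RInt_everywhere_derivable; intros y; auto_derive; trivial. }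
replace (sqrt PI / 2) with (sqrt (PI / 4)).
- apply (is_lim_comp_continuous _ sqrt _ (PI / 4) Hsq), continuous_sqrt.
- rewrite sqrt_div_alt by lra.
  replace 4 with (2 ^ 2) by ring; rewrite sqrt_pow2; lra.
Qed.

(** * The Gamma function at half-integers *)

(* An explicit primitive of [t^(k - 1/2) e^(-t)] vanishing at [0], obtained by
   iterated integration by parts; [gamma_half k] is its limit at infinity. *)
Fixpoint gamma_half_prim (k : nat) (t : R) : R :=
  match k with
  | 0%nat => 2 * gauss_int (sqrt t)
  | S k => (INR k + 1 / 2) * gamma_half_prim k t - t ^ k * sqrt t * exp (- t)
  end.

Fixpoint gamma_half (k : nat) : R :=
  match k with
  | 0%nat => sqrt PI
  | S k => (INR k + 1 / 2) * gamma_half k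
  end.

(** In the inductive step, the product rule on [t^(k+1/2) e^(-t)] yields
    [(k + 1/2) t^(k-1/2) e^(-t)], which cancels the induction hypothesis, minus the wanted
    integrand. *)
Lemma is_derive_gamma_half_prim (k : nat) (t : R) :
  0 < t -> is_derive (gamma_half_prim k) t (t ^ k / sqrt t * exp (- t)).
Proof.
intros Ht; assert (Hs : 0 < sqrt t) by now apply sqrt_lt_R0.
assert (Hss : sqrt t * sqrt t = t) by (apply sqrt_sqrt; lra).
induction k as [|k IH]; simpl gamma_half_prim.
- replace (t ^ 0 / sqrt t * exp (- t))
    with (2 * (/ (2 * sqrt t) * exp (- sqrt t ^ 2))).
  + apply (is_derive_scal (fun t => gauss_int (sqrt t))).
    apply (is_derive_comp gauss_int sqrt); [apply is_derive_gauss_int|].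
    apply is_derive_Reals, derivable_pt_lim_sqrt, Ht.
  + replace (sqrt t ^ 2) with t by (rewrite <- Hss at 1; ring).
    field; lra.
- replace (t ^ S k / sqrt t * exp (- t))
    with (minus ((INR k + 1 / 2) * (t ^ k / sqrt t * exp (- t)))
      ((INR k * t ^ pred k * sqrt t + t ^ k / (2 * sqrt t) - t ^ k * sqrt t)
       * exp (- t))).
  + apply (is_derive_minus (fun t => (INR k + 1 / 2) * gamma_half_prim k t)).
    * now apply (is_derive_scal (gamma_half_prim k)).
    * auto_derive; [easy|field; lra].
  + unfold minus, plus, opp; simpl.
    (* At [k = 0] the truncated [pred] gives the wrong power, but the factor [INR k] is zero. *)
    assert (Hk : INR k * t ^ pred k * sqrt t = INR k * t ^ k / sqrt t).
    { apply Rmult_eq_reg_r with (sqrt t); [|lra].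
      transitivity (INR k * t ^ pred k * (sqrt t * sqrt t)); [ring|].
      rewrite Hss; destruct k; [simpl; field; lra|].
      simpl pred; simpl pow; field; lra. }
    rewrite Hk.
    replace (t ^ k * sqrt t) with (t ^ k * t / sqrt t)
      by (rewrite <- Hss at 2; field; lra).
    field; lra.
Qed.

(** Needed at [t = 0], the lower end of the improper integral, which the derivative formula does not
    reach. *)
Lemma gamma_half_prim_continuous (k : nat) (t : R) :
  continuous (gamma_half_prim k) t.
Proof.
assert (Hs : continuous sqrt t) by apply continuous_sqrt.
induction k as [|k IH]; simpl gamma_half_prim.
- apply (continuous_mult (K := R_AbsRing) (fun _ => 2) (fun t => gauss_int (sqrt t)));
    [apply continuous_const|].
  apply (continuous_comp sqrt gauss_int); [exact Hs|].
  apply (ex_derive_continuous (V := R_NormedModule)).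
  eexists; apply is_derive_gauss_int.
- apply (continuous_minus (V := R_NormedModule)
           (fun t => (INR k + 1 / 2) * gamma_half_prim k t)).
  + apply (continuous_mult (K := R_AbsRing) (fun _ => INR k + 1 / 2));
      [apply continuous_const|exact IH].
  + apply (continuous_mult (K := R_AbsRing) (fun t => t ^ k * sqrt t)).
    * apply (continuous_mult (K := R_AbsRing) (fun t => t ^ k)); [|exact Hs].
      apply (ex_derive_continuous (V := R_NormedModule)); auto_derive; trivial.
    * apply (ex_derive_continuous (V := R_NormedModule)); auto_derive; trivial.
Qed.

Lemma gamma_half_prim_0 (k : nat) : gamma_half_prim k 0 = 0.
Proof.
induction k as [|k IH]; simpl; rewrite sqrt_0.
- rewrite gauss_int_0; apply Rmult_0_r.
- rewrite IH; ring.
Qed.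

Lemma is_lim_gamma_half_prim (k : nat) :
  is_lim (gamma_half_prim k) p_infty (gamma_half k).
Proof.
induction k as [|k IH]; simpl.
- replace (sqrt PI) with (2 * (sqrt PI / 2)) by field.
  apply (is_lim_scal_l (fun t => gauss_int (sqrt t)) 2 p_infty (sqrt PI / 2)).
  apply (is_lim_comp gauss_int sqrt _ _ p_infty is_lim_gauss_int).
  + apply is_lim_sqrt_p, is_lim_id.
  + now apply filter_forall.
- replace ((INR k + 1 / 2) * gamma_half k)
    with ((INR k + 1 / 2) * gamma_half k - 0) by ring.
  apply is_lim_minus'.
  + apply (is_lim_scal_l _ (INR k + 1 / 2) p_infty (gamma_half k) IH).
  + apply (is_lim_le_le_loc (fun _ => 0) (fun t => t ^ S k * exp (- t)));
      [|apply is_lim_const|apply is_lim_pow_exp_neg].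
    exists 1; intros t Ht.
    assert (0 < t ^ k) by (apply pow_lt; lra).
    assert (0 < sqrt t) by (apply sqrt_lt_R0; lra).
    assert (sqrt t <= t).
    { assert (sqrt t * sqrt t = t) by (apply sqrt_sqrt; lra).
      assert (1 <= sqrt t) by (rewrite <- sqrt_1; apply sqrt_le_1; lra).
      nra. }
    pose proof (exp_pos (- t)).
    split; [apply Rlt_le; repeat apply Rmult_lt_0_compat; lra|].
    apply Rmult_le_compat_r; [lra|]; simpl; nra.
Qed.

(** The fundamental theorem of calculus for the improper integral: the primitive tends to [0] at the
    left end and to [gamma_half k] at infinity. *)
Lemma Gamma_half (k : nat) : Gamma ((2 * INR k + 1) / 2) = gamma_half k.
Proof.
unfold Gamma; apply (is_RInt_gen_unique (V := R_CompleteNormedModule)).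
replace (gamma_half k) with (gamma_half k - 0) by ring.
(* Both endpoints are eventually positive, so the whole interval between them lies where the
   primitive is differentiable. *)
assert (Hpos : filter_prod (at_right 0) (Rbar_locally p_infty)
  (fun ab => forall x, Rmin (fst ab) (snd ab) <= x -> 0 < x)).
{ apply Filter_prod with (fun x => 0 < x) (fun x => 0 < x).
  - exists (mkposreal 1 Rlt_0_1); intros y _ Hy; exact Hy.
  - exists 0; trivial.
  - intros a b Ha Hb x Hx; apply Rlt_le_trans with (2 := Hx).
    now apply Rmin_glb_lt. }
apply (is_RInt_gen_ext (Derive (gamma_half_prim k))).
{ revert Hpos; apply filter_imp; intros ab Hab x [Hx _].
  assert (Hx0 : 0 < x) by (apply Hab; lra).
  transitivity (x ^ k / sqrt x * exp (- x));
    [now apply is_derive_unique, is_derive_gamma_half_prim|].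
  f_equal.
  replace ((2 * INR k + 1) / 2 - 1) with (INR k + - / 2) by field.
  now rewrite Rpower_plus, Rpower_Ropp, Rpower_pow, Rpower_sqrt. }
apply is_RInt_gen_Derive.
- revert Hpos; apply filter_imp; intros ab Hab x [Hx _].
  eexists; apply is_derive_gamma_half_prim; auto.
- revert Hpos; apply filter_imp; intros ab Hab x [Hx _].
  assert (Hx0 : 0 < x) by auto.
  apply (continuous_ext_loc _ (fun t => t ^ k / sqrt t * exp (- t))).
  + apply (filter_imp (fun y => 0 < y)).
    * intros y Hy; symmetry; apply is_derive_unique.
      now apply is_derive_gamma_half_prim.
    * now apply open_gt.
  + apply (ex_derive_continuous (V := R_NormedModule)).
    assert (0 < sqrt x) by now apply sqrt_lt_R0.
    auto_derive; repeat split; lra.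
- pose proof (gamma_half_prim_continuous k 0) as H; unfold continuous in H.
  rewrite gamma_half_prim_0 in H; revert H.
  apply filterlim_filter_le_1, filter_le_within.
- apply is_lim_gamma_half_prim.
Qed.

(** * Finite sums of products of a function of [t] and a function of [x] *)

Lemma continuous_on_fst (f : R -> R) (z : R * R) :
  (forall x, ex_derive f x) -> continuous (fun z : R * R => f (fst z)) z.
Proof.
intros Hf; apply (continuous_comp fst f).
- destruct z; apply continuous_fst.
- apply (ex_derive_continuous (V := R_NormedModule)), Hf.
Qed.

Lemma continuous_on_snd (f : R -> R) (z : R * R) :
  (forall x, ex_derive f x) -> continuous (fun z : R * R => f (snd z)) z.
Proof.
intros Hf; apply (continuous_comp snd f).
- destruct z; apply continuous_snd.
- apply (ex_derive_continuous (V := R_NormedModule)), Hf.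
Qed.

(** With the two families as parameters, a partial derivative of the sum is again such a sum, with
    just one family replaced. *)
Definition separated_sum (a : nat -> R) (f g : nat -> R -> R) (n : nat)
    (x t : R) : R :=
  sum_f_R0 (fun k => a k * f k t * g k x) n.

Lemma is_derive_separated_sum_x a f g g' n x t :
  (forall k, is_derive (g k) x (g' k x)) ->
  is_derive (fun x => separated_sum a f g n x t) x
    (separated_sum a f g' n x t).
Proof.
intros Hg; unfold separated_sum; induction n as [|n IH]; simpl.
- now apply (is_derive_scal (g 0%nat)).
- apply (is_derive_plus (fun x => sum_f_R0 (fun k => a k * f k t * g k x) n));
    [exact IH|now apply (is_derive_scal (g (S n)))].
Qed.

Lemma separated_sum_swap a f g n x t :
  separated_sum a f g n x t = separated_sum a g f n t x.
Proof. apply sum_eq; intros k _; ring. Qed.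

Lemma is_derive_separated_sum_t a f f' g n x t :
  (forall k, is_derive (f k) t (f' k t)) ->
  is_derive (fun t => separated_sum a f g n x t) t
    (separated_sum a f' g n x t).
Proof.
intros Hf; rewrite separated_sum_swap.
apply (is_derive_ext (fun t => separated_sum a g f n t x));
  [intros s; apply separated_sum_swap|].
now apply is_derive_separated_sum_x.
Qed.

Lemma separated_sum_continuous a f g n (z : R * R) :
  (forall k t, ex_derive (f k) t) -> (forall k x, ex_derive (g k) x) ->
  continuous (fun z : R * R => separated_sum a f g n (fst z) (snd z)) z.
Proof.
intros Hf Hg.
assert (Hterm : forall k, continuous
  (fun z : R * R => a k * f k (snd z) * g k (fst z)) z).
{ intros k.
  apply (continuous_mult (K := R_AbsRing) (fun z : R * R => a k * f k (snd z)));
    [|now apply continuous_on_fst].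
  apply (continuous_mult (K := R_AbsRing) (fun _ => a k));
    [apply continuous_const|now apply continuous_on_snd]. }
unfold separated_sum; induction n as [|n IH]; simpl; [apply Hterm|].
now apply (continuous_plus (V := R_NormedModule)
  (fun z : R * R => sum_f_R0 (fun k => a k * f k (snd z) * g k (fst z)) n)).
Qed.

(** * The heat polynomial [u0] *)

Definition heat_coef (p k : nat) : R :=
  Binomial.C (2 * p + 1) (2 * k) * Gamma ((2 * INR k + 1) / 2).

(** First and second derivatives of [x^n]. They are right for small [n] too: wherever [pred]
    truncates, a coefficient vanishes. *)
Definition dpow (n : nat) (x : R) : R := INR n * x ^ pred n.
Definition ddpow (n : nat) (x : R) : R := INR n * (INR (pred n) * x ^ pred (pred n)).

Lemma is_derive_monomial (n : nat) (x : R) :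
  is_derive (fun x => x ^ n) x (dpow n x).
Proof. unfold dpow; auto_derive; [trivial|ring]. Qed.

Lemma is_derive_dpow (n : nat) (x : R) : is_derive (dpow n) x (ddpow n x).
Proof. unfold dpow, ddpow; auto_derive; [trivial|ring]. Qed.

Lemma is_derive_4t_pow (k : nat) (t : R) :
  is_derive (fun t => (4 * t) ^ k) t (4 * dpow k (4 * t)).
Proof. unfold dpow; auto_derive; [trivial|ring]. Qed.

(** Two steps along the row of Pascal's triangle bring the denominator [(2k+1)(2k+2)], which equals
    [4 (k+1) (k+1/2)]; the last factor comes from the Gamma recursion. *)
Lemma heat_coef_rec (p k : nat) :
  (k < p)%nat ->
  heat_coef p (S k) * (4 * INR (S k))
  = heat_coef p k
    * (INR (2 * p + 1 - 2 * k) * INR (pred (2 * p + 1 - 2 * k))).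
Proof.
intros Hk; unfold heat_coef; rewrite !Gamma_half; simpl gamma_half.
replace (2 * S k)%nat with (S (S (2 * k))) by lia.
rewrite !pascal_step3 by lia.
replace (2 * p + 1 - S (2 * k))%nat with (pred (2 * p + 1 - 2 * k)) by lia.
rewrite !S_INR, (mult_INR 2 k); simpl (INR 2).
pose proof (pos_INR k); field; lra.
Qed.

(** The term [k = 0] of the time derivative vanishes, and so does the term [k = p] of the second
    space derivative, being linear in [x]. The others match after a shift of the index by one. *)
Lemma heat_equation_sum (p : nat) (x t : R) :
  separated_sum (heat_coef p) (fun k t => 4 * dpow k (4 * t))
    (fun k x => x ^ (2 * p + 1 - 2 * k)) p x t
  = separated_sum (heat_coef p) (fun k t => (4 * t) ^ k)
      (fun k => ddpow (2 * p + 1 - 2 * k)) p x t.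
Proof.
unfold separated_sum; destruct p as [|p].
- unfold dpow, ddpow; simpl; ring.
- rewrite decomp_sum by lia; rewrite tech5.
  replace (2 * S p + 1 - 2 * S p)%nat with 1%nat by lia.
  simpl (pred (S p)).
  unfold dpow at 1; unfold ddpow at 2; simpl (INR 0); simpl (INR (pred 1)).
  rewrite (sum_eq _ (fun k => heat_coef (S p) k * (4 * t) ^ k
             * ddpow (2 * S p + 1 - 2 * k) x)); [ring|].
  intros k Hk.
  assert (H := heat_coef_rec (S p) k ltac:(lia)).
  unfold dpow, ddpow.
  replace (2 * S p + 1 - 2 * S k)%nat
    with (pred (pred (2 * S p + 1 - 2 * k))) by lia.
  simpl (pred (S k)).
  transitivity (heat_coef (S p) (S k) * (4 * INR (S k)) * (4 * t) ^ k
                * x ^ pred (pred (2 * S p + 1 - 2 * k))); [ring|].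
  rewrite H; ring.
Qed.

Lemma u0_initial (eta : R) (p : nat) (x : R) :
  u0 eta p x 0 = eta * x ^ (2 * p + 1).
Proof.
assert (Hpi : 0 < sqrt PI) by apply sqrt_lt_R0, PI_RGT_0.
(* The number of terms is freed from [p] for the induction; only [k = 0] contributes, through
   [0^0 = 1]. *)
assert (H : forall n, sum_f_R0 (fun k => Binomial.C (2 * p + 1) (2 * k)
    * Gamma ((2 * INR k + 1) / 2) * (4 * 0) ^ k * x ^ (2 * p + 1 - 2 * k)) n
    = sqrt PI * x ^ (2 * p + 1)).
{ induction n as [|n IH].
  - unfold sum_f_R0; rewrite C_n_0, Gamma_half.
    replace (2 * p + 1 - 2 * 0)%nat with (2 * p + 1)%nat by lia.
    simpl gamma_half; ring.
  - rewrite tech5, IH; simpl ((4 * 0) ^ S n); ring. }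
unfold u0; rewrite H; field; lra.
Qed.

Lemma u0_boundary (eta : R) (p : nat) (t : R) : u0 eta p 0 t = 0.
Proof.
unfold u0; rewrite (sum_eq _ (fun _ => 0)), sum_cte; [ring|].
intros k Hk; rewrite pow_i by lia; ring.
Qed.

(** Only the term [k = p], linear in [x], has a nonzero slope at [0]. Its binomial coefficient is
    [m], and [4^p = 2^(m-1)]. *)
Lemma u0_boundary_slope (eta : R) (p : nat) (t : R) :
  eta / sqrt PI
  * separated_sum (heat_coef p) (fun k t => (4 * t) ^ k)
      (fun k => dpow (2 * p + 1 - 2 * k)) p 0 t
  = c_const eta p * t ^ p.
Proof.
assert (Hlast : heat_coef p p = INR (2 * p + 1) * Gamma (INR (2 * p + 1) / 2)).
{ unfold heat_coef; rewrite pascal_step1 by lia.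
  replace (2 * p + 1 - 2 * p)%nat with 1%nat by lia.
  rewrite pascal_step3, C_n_0 by lia.
  replace (2 * p + 1 - 0)%nat with (2 * p + 1)%nat by lia.
  f_equal; [simpl (INR 1); field|].
  now rewrite plus_INR, mult_INR. }
assert (Hp : separated_sum (heat_coef p) (fun k t => (4 * t) ^ k)
      (fun k => dpow (2 * p + 1 - 2 * k)) p 0 t = heat_coef p p * (4 * t) ^ p).
{ unfold separated_sum.
  assert (H1 : dpow (2 * p + 1 - 2 * p) 0 = 1).
  { replace (2 * p + 1 - 2 * p)%nat with 1%nat by lia.
    unfold dpow; simpl; ring. }
  destruct p as [|p]; [simpl in *; rewrite H1; ring|].
  rewrite tech5, H1, (sum_eq _ (fun _ => 0)), sum_cte; [ring|].
  intros k Hk; unfold dpow; rewrite pow_i by lia; ring. }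
rewrite Hp, Hlast, Rpow_mult_distr; unfold c_const.
replace (2 * p + 1 - 1)%nat with (2 * p)%nat by lia.
rewrite pow_mult; replace (2 ^ 2) with 4 by ring.
assert (0 < sqrt PI) by apply sqrt_lt_R0, PI_RGT_0.
field; lra.
Qed.

(** * The remainder of the exponential series *)

(** Only degrees below [n] are summed, so that [p = 0] gives the empty sum and fits the uniform
    formula for [V]. *)
Fixpoint exp_partial (n : nat) (x : R) : R :=
  match n with
  | 0%nat => 0
  | S n => exp_partial n x + x ^ n / INR (fact n)
  end.

Lemma sum_f_exp_partial (a t : R) (n : nat) :
  sum_f 1 (S n) (fun k => a ^ k / INR (fact k) * t ^ k) + 1
  = exp_partial (S (S n)) (a * t).
Proof.
assert (Hterm : forall k, a ^ k / INR (fact k) * t ^ k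
                          = (a * t) ^ k / INR (fact k)).
{ intros k; rewrite Rpow_mult_distr; unfold Rdiv; ring. }
unfold sum_f; replace (S n - 1)%nat with n by lia.
induction n as [|n IH].
- simpl; field.
- rewrite tech5; rewrite Hterm; replace (S n + 1)%nat with (S (S n)) by lia.
  change (exp_partial (S (S (S n))) (a * t))
    with (exp_partial (S (S n)) (a * t)
          + (a * t) ^ S (S n) / INR (fact (S (S n)))).
  rewrite <- IH; ring.
Qed.

Lemma is_derive_exp_partial (n : nat) (x : R) :
  is_derive (exp_partial (S n)) x (exp_partial n x).
Proof.
induction n as [|n IH].
- apply (is_derive_ext (fun _ => 1)); [intros y; simpl; field|].
  apply (is_derive_const (V := R_NormedModule)).
- apply (is_derive_plus (exp_partial (S n))); [exact IH|].
  assert (Hf : INR (fact n) <> 0) by apply INR_fact_neq_0.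
  assert (Hn : INR (S n) <> 0) by now apply not_0_INR.
  auto_derive; [trivial|].
  change (1 * (INR (S n) * x ^ n) * / INR (fact (S n)) = x ^ n / INR (fact n)).
  rewrite fact_simpl, mult_INR; field; auto.
Qed.

(** Differentiation lowers the order of the remainder by one, which adds back the term
    [x^(n-1) / (n-1)!]; this is [dpow n x / n!], and zero for [n = 0]. *)
Lemma is_derive_exp_remainder (n : nat) (x : R) :
  is_derive (fun x => exp x - exp_partial n x) x
    (exp x - exp_partial n x + dpow n x / INR (fact n)).
Proof.
destruct n as [|n].
- simpl; unfold dpow; auto_derive; [trivial|simpl; field].
- replace (exp x - exp_partial (S n) x + dpow (S n) x / INR (fact (S n)))
    with (minus (exp x) (exp_partial n x)).
  + apply (is_derive_minus exp); [|apply is_derive_exp_partial].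
    apply is_derive_exp.
  + assert (INR (fact n) <> 0) by apply INR_fact_neq_0.
    assert (INR (S n) <> 0) by now apply not_0_INR.
    symmetry.
    change (exp x - (exp_partial n x + x ^ n / INR (fact n))
            + INR (S n) * x ^ n / INR (fact (S n)) = exp x - exp_partial n x).
    rewrite fact_simpl, mult_INR; field; auto.
Qed.

Lemma powerRZ_m1_pred (p : nat) : powerRZ (-1) (Z.of_nat p - 1) = - (-1) ^ p.
Proof.
unfold Z.sub; rewrite powerRZ_add by lra.
rewrite <- pow_powerRZ; simpl (powerRZ (-1) (- (1))); field.
Qed.

(** * The boundary slope [V]: uniform formula, differential equation, integral equation *)

Lemma V_remainder (nu lambda mu eta : R) (p : nat) (t : R) :
  0 < nu -> 0 < lambda -> 0 < mu -> lambda - nu * mu <> 0 ->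
  let delta := lambda - nu * mu in
  V nu lambda mu eta p t
  = c_const eta p * lambda / delta * t ^ p
    + c3 nu lambda mu eta p
      * (exp (- (lambda * delta) * t) - exp_partial p (- (lambda * delta) * t)).
Proof.
intros Hnu Hlambda Hmu Hdelta delta; fold delta in Hdelta.
unfold V; fold delta.
replace (- (lambda * delta * t)) with (- (lambda * delta) * t) by ring.
assert (Hpi : 0 < sqrt PI) by apply sqrt_lt_R0, PI_RGT_0.
enough (H : p3 nu lambda mu eta p t = c_const eta p * lambda / delta * t ^ p
   - c3 nu lambda mu eta p * exp_partial p (- (lambda * delta) * t))
  by (rewrite H; ring).
destruct p as [|[|[|p]]]; unfold p3; fold delta.
(* This is [Gamma (1/2) = sqrt PI]. *)
- assert (Hc : c_const eta 0 = eta).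
  { unfold c_const.
    replace (INR (2 * 0 + 1) / 2) with ((2 * INR 0 + 1) / 2)
      by (simpl; field).
    rewrite Gamma_half; simpl; field; lra. }
  rewrite Hc; simpl; field; exact Hdelta.
- unfold c3; fold delta; rewrite powerRZ_m1_pred; simpl; field; lra.
- unfold c3; fold delta; rewrite powerRZ_m1_pred; simpl; field; lra.
- replace (S (S (S p)) - 1)%nat with (S (S p)) by lia.
  now rewrite sum_f_exp_partial.
Qed.

Lemma is_derive_V (nu lambda mu eta : R) (p : nat) (t : R) :
  0 < nu -> 0 < lambda -> 0 < mu -> lambda - nu * mu <> 0 ->
  is_derive (V nu lambda mu eta p) t
    (c_const eta p * dpow p t + lambda ^ 2 * c_const eta p * t ^ p
     - lambda * (lambda - nu * mu) * V nu lambda mu eta p t).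
Proof.
intros Hnu Hlambda Hmu Hdelta.
apply (is_derive_ext (fun t => c_const eta p * lambda / (lambda - nu * mu) * t ^ p
    + c3 nu lambda mu eta p
      * (exp (- (lambda * (lambda - nu * mu)) * t)
         - exp_partial p (- (lambda * (lambda - nu * mu)) * t)))).
{ intros s; symmetry; now apply V_remainder. }
rewrite V_remainder by assumption; cbv zeta.
set (delta := lambda - nu * mu) in *.
set (L := - (lambda * delta)).
assert (HR := is_derive_comp _ (fun t => L * t) t _ L
                (is_derive_exp_remainder p (L * t))
                ltac:(auto_derive; [trivial|ring])).
assert (HS := is_derive_plus _ _ t _ _
   (is_derive_scal _ t (c_const eta p * lambda / delta) _ (is_derive_monomial p t))
   (is_derive_scal _ t (c3 nu lambda mu eta p) _ HR)).
match type of HS with is_derive _ _ ?l =>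
  match goal with |- is_derive _ _ ?l' => replace l' with l end end;
  [exact HS|].
unfold plus, scal; simpl; unfold mult; simpl.
(* The factors [p!], [(lambda delta)^p] and the sign in [c3] are exactly those that cancel here. *)
assert (Hc3 : c3 nu lambda mu eta p * (L * (dpow p (L * t) / INR (fact p)))
   = - (c_const eta p * nu * mu / delta) * dpow p t).
{ unfold c3; fold delta; rewrite powerRZ_m1_pred.
  assert (HL : L * dpow p (L * t) = L ^ p * dpow p t).
  { unfold dpow; destruct p; [simpl; ring|].
    simpl pred; rewrite Rpow_mult_distr; simpl pow; ring. }
  assert (HLp : L ^ p = (-1) ^ p * (lambda * delta) ^ p).
  { rewrite <- Rpow_mult_distr; unfold L; f_equal; ring. }
  assert (Hsgn : (-1) ^ p * (-1) ^ p = 1).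
  { rewrite <- Rpow_mult_distr; replace (-1 * -1) with 1 by ring; apply pow1. }
  assert (Hd : (lambda * delta) ^ p <> 0).
  { apply pow_nonzero, Rmult_integral_contrapositive; lra. }
  assert (INR (fact p) <> 0) by apply INR_fact_neq_0.
  transitivity (- ((-1) ^ p * (-1) ^ p)
    * (c_const eta p * nu * mu / delta) * dpow p t); [|rewrite Hsgn; ring].
  transitivity (- (-1) ^ p * (c_const eta p * nu * mu * INR (fact p)
     / (delta * (lambda * delta) ^ p)) * (L * dpow p (L * t) / INR (fact p)));
    [unfold Rdiv; ring|].
  rewrite HL, HLp; field; auto. }
(* Since [lambda = delta + nu mu], the second summand cancels the one from [Hc3] and leaves
   [c p t^(p-1)]. *)
assert (Hl : c_const eta p * lambda / delta * dpow p t
   = c_const eta p * dpow p t + c_const eta p * nu * mu / delta * dpow p t).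
{ unfold delta in *; field; assumption. }
transitivity (c_const eta p * lambda / delta * dpow p t
  + c3 nu lambda mu eta p * (L * (dpow p (L * t) / INR (fact p)))
  + L * c3 nu lambda mu eta p * (exp (L * t) - exp_partial p (L * t))); [ring|].
rewrite Hc3, Hl; unfold L; field; exact Hdelta.
Qed.

(** For [p = 0] the remainder is [1] and [c lambda / delta + c3 = c]; for positive [p] both the
    power and the remainder vanish at [0]. *)
Lemma V_0 (nu lambda mu eta : R) (p : nat) :
  0 < nu -> 0 < lambda -> 0 < mu -> lambda - nu * mu <> 0 ->
  V nu lambda mu eta p 0 = c_const eta p * 0 ^ p.
Proof.
intros Hnu Hlambda Hmu Hdelta; rewrite V_remainder by assumption; cbv zeta.
rewrite Rmult_0_r, exp_0; destruct p as [|p].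
- unfold c3; simpl; field; assumption.
- replace (exp_partial (S p) 0) with 1; [simpl; ring|].
  induction p as [|p IH]; [simpl; field|].
  change (exp_partial (S (S p)) 0)
    with (exp_partial (S p) 0 + 0 ^ S p / INR (fact (S p))).
  rewrite <- IH, pow_i by lia; unfold Rdiv; ring.
Qed.

Definition V_integral (nu lambda mu eta : R) (p : nat) (t : R) : R :=
  RInt (fun tau => V nu lambda mu eta p tau * exp (lambda ^ 2 * tau)) 0 t.

Lemma is_derive_V_integral (nu lambda mu eta : R) (p : nat) (t : R) :
  0 < nu -> 0 < lambda -> 0 < mu -> lambda - nu * mu <> 0 ->
  is_derive (V_integral nu lambda mu eta p) t
    (V nu lambda mu eta p t * exp (lambda ^ 2 * t)).
Proof.
intros Hnu Hlambda Hmu Hdelta.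
apply (is_derive_RInt_upper
  (fun tau => V nu lambda mu eta p tau * exp (lambda ^ 2 * tau))).
intros s; apply ex_derive_mult; [|auto_derive; trivial].
eexists; now apply is_derive_V.
Qed.

Lemma V_volterra (nu lambda mu eta : R) (p : nat) (t : R) :
  0 < nu -> 0 < lambda -> 0 < mu -> lambda - nu * mu <> 0 -> 0 < t ->
  V nu lambda mu eta p t
  = c_const eta p * t ^ p
    + nu * mu * lambda * (exp (- (lambda ^ 2 * t))
                          * V_integral nu lambda mu eta p t).
Proof.
intros Hnu Hlambda Hmu Hdelta Ht.
(* [D] is the difference of the two sides times [exp (lambda^2 t)]. Its derivative is zero by the
   differential equation for [V], as [lambda - delta = nu mu], and [D 0 = 0] by [V_0]. *)
set (D := fun t => exp (lambda ^ 2 * t)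
  * (V nu lambda mu eta p t - c_const eta p * t ^ p)
  - nu * mu * lambda * V_integral nu lambda mu eta p t).
assert (HD : D 0 = D t).
{ apply (eq_is_derive D); [|exact Ht].
  intros s _; unfold D.
  auto_derive.
  - repeat split; trivial.
    + eexists; now apply is_derive_V.
    + eexists; now apply is_derive_V_integral.
  - replace (Derive (fun x => V nu lambda mu eta p x) s)
      with (c_const eta p * dpow p s + lambda ^ 2 * c_const eta p * s ^ p
            - lambda * (lambda - nu * mu) * V nu lambda mu eta p s)
      by (symmetry; now apply is_derive_unique, is_derive_V).
    replace (Derive (fun x => V_integral nu lambda mu eta p x) s)
      with (V nu lambda mu eta p s * exp (lambda ^ 2 * s))
      by (symmetry; now apply is_derive_unique, is_derive_V_integral).
    unfold dpow, zero; simpl; ring. }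
unfold D in HD; rewrite V_0 in HD by assumption.
replace (V_integral nu lambda mu eta p 0) with 0 in HD
  by (unfold V_integral; now rewrite RInt_point).
assert (HE : exp (- (lambda ^ 2 * t)) * exp (lambda ^ 2 * t) = 1).
{ rewrite <- exp_plus; rewrite <- exp_0; f_equal; ring. }
assert (H1 : exp (lambda ^ 2 * t) * (V nu lambda mu eta p t - c_const eta p * t ^ p)
  = nu * mu * lambda * V_integral nu lambda mu eta p t) by lra.
transitivity (c_const eta p * t ^ p
  + exp (- (lambda ^ 2 * t)) * exp (lambda ^ 2 * t)
    * (V nu lambda mu eta p t - c_const eta p * t ^ p)); [rewrite HE; ring|].
rewrite Rmult_assoc, H1; ring.
Qed.

(** * From a smooth extension to a classical solution *)

Lemma is_derive_right (f : R -> R) (x l : R) :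
  is_derive f x l -> is_right_derive f x l.
Proof.
intros Hf; apply is_derive_Reals in Hf.
intros P [eps HP]; destruct (Hf eps (cond_pos eps)) as [d Hd].
exists d; intros y Hy Hxy; apply HP.
specialize (Hd (y - x) ltac:(lra) Hy).
rewrite Rplus_minus in Hd; exact Hd.
Qed.

Lemma is_right_derive_ext (f g : R -> R) (x l : R) :
  (forall y, x <= y -> f y = g y) -> is_right_derive f x l ->
  is_right_derive g x l.
Proof.
intros Hfg; apply filterlim_ext_loc.
exists (mkposreal 1 Rlt_0_1); intros y _ Hy.
rewrite !Hfg; [reflexivity|lra|lra].
Qed.

(** [Phi], hence [u], is known only for [x >= 0], while its formula [U] is smooth on the whole
    plane. Derivatives at [x > 0] are local and carry over from [U] to [u]; at [x = 0] the right
    derivative does. *)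
Lemma solves_problem_P_of_derivatives
    (Phi : R -> R) (F : R -> R -> R) (h : R -> R) (u U U_t U_x U_xx : R -> R -> R) :
  (forall x t, 0 <= x -> u x t = U x t) ->
  (forall x t, is_derive (fun s => U x s) t (U_t x t)) ->
  (forall x t, is_derive (fun y => U y t) x (U_x x t)) ->
  (forall x t, is_derive (fun y => U_x y t) x (U_xx x t)) ->
  (forall z : R * R, continuous (fun z : R * R => U (fst z) (snd z)) z) ->
  (forall z : R * R, continuous (fun z : R * R => U_t (fst z) (snd z)) z) ->
  (forall z : R * R, continuous (fun z : R * R => U_x (fst z) (snd z)) z) ->
  (forall z : R * R, continuous (fun z : R * R => U_xx (fst z) (snd z)) z) ->
  (forall x t, 0 < x -> 0 < t ->
     U_t x t - U_xx x t = - Phi x * F (U_x 0 t) t) ->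
  (forall x, 0 < x -> U x 0 = h x) ->
  (forall t, 0 < t -> U 0 t = 0) ->
  solves_problem_P Phi F h u /\
  (forall t, 0 < t -> is_right_derive (fun x => u x t) 0 (U_x 0 t)).
Proof.
intros Hu Ht Hx Hxx Cu Ct Cx Cxx Heq Hini Hbd.
assert (Hloc : forall x (P : R -> Prop), 0 < x ->
          (forall y, 0 < y -> P y) -> locally x P).
{ intros x P Hx0 HP; apply (filter_imp (fun y => 0 < y)); [exact HP|].
  now apply open_gt. }
assert (Dt : forall x t, 0 < x -> is_derive (fun s => u x s) t (U_t x t)).
{ intros x t Hx0; apply (is_derive_ext (fun s => U x s)); [|apply Ht].
  intros s; symmetry; apply Hu; lra. }
assert (Dx : forall x t, 0 < x -> is_derive (fun y => u y t) x (U_x x t)).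
{ intros x t Hx0; apply (is_derive_ext_loc (fun y => U y t)); [|apply Hx].
  apply Hloc; [exact Hx0|]; intros y Hy; symmetry; apply Hu; lra. }
assert (Dxx : forall x t, 0 < x ->
  is_derive (fun y => Derive (fun y => u y t) y) x (U_xx x t)).
{ intros x t Hx0; apply (is_derive_ext_loc (fun y => U_x y t)); [|apply Hxx].
  apply Hloc; [exact Hx0|]; intros y Hy.
  symmetry; now apply is_derive_unique, Dx. }
assert (HR : forall t, 0 < t -> is_right_derive (fun x => u x t) 0 (U_x 0 t)).
{ intros t _; apply (is_right_derive_ext (fun x => U x t)).
  - intros y Hy; symmetry; now apply Hu.
  - apply is_derive_right, Hx. }
split; [|exact HR].
exists (fun t => U_x 0 t); repeat split.
- exact HR.
- eexists; now apply Dt.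
- eexists; now apply Dx.
- eexists; now apply Dxx.
- apply (continuous_on_ext _ (fun z : R * R => U (fst z) (snd z))).
  + intros z [Hz _]; symmetry; now apply Hu.
  + apply continuous_on_forall; intros z _; apply Cu.
- apply (continuous_on_ext _ (fun z : R * R => U_t (fst z) (snd z))).
  + intros z [Hz _]; symmetry; now apply is_derive_unique, Dt.
  + apply continuous_on_forall; intros z _; apply Ct.
- apply (continuous_on_ext _ (fun z : R * R => U_x (fst z) (snd z))).
  + intros z [Hz _]; symmetry; now apply is_derive_unique, Dx.
  + apply continuous_on_forall; intros z _; apply Cx.
- apply (continuous_on_ext _ (fun z : R * R => U_xx (fst z) (snd z))).
  + intros z [Hz _]; symmetry; now apply is_derive_unique, Dxx.
  + apply continuous_on_forall; intros z _; apply Cxx.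
- intros x t Hx0 Ht0.
  rewrite <- (Heq x t Hx0 Ht0); f_equal; [|f_equal].
  + now apply is_derive_unique, Dt.
  + now apply is_derive_unique, Dxx.
- intros x Hx0; rewrite Hu by lra; now apply Hini.
- intros t Ht0; rewrite Hu by lra; now apply Hbd.
Qed.

(** * Assembly of the solution *)

Theorem proposition2p7 :
  forall (nu lambda mu eta delta : R) (p m : nat)
         (F : R -> R -> R) (h Phi : R -> R),
    0 < nu -> 0 < lambda -> 0 < mu -> eta <> 0 ->
    delta = lambda - nu * mu -> delta <> 0 ->
    m = (2 * p + 1)%nat ->
    (forall W t : R, 0 < t -> F W t = nu * W) ->
    (forall x : R, 0 <= x -> h x = eta * x ^ m) ->
    (forall x : R, 0 <= x -> Phi x = - mu * sin (lambda * x)) ->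
    let u := u_sol nu lambda mu eta p Phi in
    solves_problem_P Phi F h u /\
    (forall t : R, 0 < t ->
       is_right_derive (fun x => u x t) 0 (V nu lambda mu eta p t)).
Proof.
intros nu lambda mu eta delta p m F h Phi Hnu Hlambda Hmu _ Hd Hdelta Hm HF Hh HPhi u.
rewrite Hd in Hdelta; clear delta Hd; subst m.
set (q := fun t => nu * mu * (exp (- (lambda ^ 2 * t))
                              * V_integral nu lambda mu eta p t)).
set (q' := fun t => nu * mu * V nu lambda mu eta p t - lambda ^ 2 * q t).
set (f := fun (k : nat) t => (4 * t) ^ k).
set (f' := fun (k : nat) t => 4 * dpow k (4 * t)).
set (g := fun (k : nat) (x : R) => x ^ (2 * p + 1 - 2 * k)).
set (g' := fun (k : nat) => dpow (2 * p + 1 - 2 * k)).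
set (g'' := fun (k : nat) => ddpow (2 * p + 1 - 2 * k)).
set (s := fun x => sin (lambda * x)).
set (s' := fun x => lambda * cos (lambda * x)).
set (s'' := fun x => - (lambda ^ 2 * s x)).
(* One shape for [u] and its derivatives [u_t], [u_x], [u_xx]: they differ only in which ingredients
   are primed, so differentiation and continuity are proved once for the shape. *)
pose (W := fun (f g : nat -> R -> R) (q s : R -> R) (x t : R) =>
  eta / sqrt PI * separated_sum (heat_coef p) f g p x t + q t * s x).
assert (Df : forall k t, is_derive (f k) t (f' k t)) by (intros; apply is_derive_4t_pow).
assert (Dg : forall k x, is_derive (g k) x (g' k x)) by (intros; apply is_derive_monomial).
assert (Dg' : forall k x, is_derive (g' k) x (g'' k x)) by (intros; apply is_derive_dpow).
assert (Ds : forall x, is_derive s x (s' x)).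
{ intros x; unfold s, s'; auto_derive; [trivial|ring]. }
assert (Ds' : forall x, is_derive s' x (s'' x)).
{ intros x; unfold s', s'', s; auto_derive; [trivial|ring]. }
assert (Dq : forall t, is_derive q t (q' t)).
{ intros t; unfold q', q; auto_derive.
  - repeat split; trivial; eexists; now apply is_derive_V_integral.
  - replace (Derive (fun x => V_integral nu lambda mu eta p x) t)
      with (V nu lambda mu eta p t * exp (lambda ^ 2 * t))
      by (symmetry; now apply is_derive_unique, is_derive_V_integral).
    replace (lambda * (lambda * 1)) with (lambda ^ 2) by ring.
    rewrite exp_Ropp; field; apply Rgt_not_eq, exp_pos. }
assert (DWx : forall f g g' q s s' x t,
  (forall k x, is_derive (g k) x (g' k x)) -> (forall x, is_derive s x (s' x)) ->
  is_derive (fun x => W f g q s x t) x (W f g' q s' x t)).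
{ clear; intros f g g' q s s' x t Dg Ds; unfold W.
  apply (is_derive_plus (fun x => eta / sqrt PI * separated_sum _ f g p x t)).
  - apply (is_derive_scal (fun x => separated_sum _ f g p x t)).
    now apply is_derive_separated_sum_x.
  - now apply (is_derive_scal s). }
assert (DWt : forall x t, is_derive (fun t => W f g q s x t) t (W f' g q' s x t)).
{ intros x t; unfold W.
  apply (is_derive_plus (fun t => eta / sqrt PI * separated_sum _ f g p x t)).
  - apply (is_derive_scal (fun t => separated_sum _ f g p x t)).
    now apply is_derive_separated_sum_t.
  - apply (is_derive_scal_l (V := R_NormedModule) q), Dq. }
assert (CW : forall f g q s z,
  (forall k t, ex_derive (f k) t) -> (forall k x, ex_derive (g k) x) ->
  (forall t, ex_derive q t) -> (forall x, ex_derive s x) ->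
  continuous (fun z : R * R => W f g q s (fst z) (snd z)) z).
{ clear; intros f g q s z Ef Eg Eq Es; unfold W.
  apply (continuous_plus (V := R_NormedModule)
    (fun z : R * R => eta / sqrt PI * separated_sum _ f g p (fst z) (snd z))).
  - apply (continuous_mult (K := R_AbsRing) (fun _ => eta / sqrt PI));
      [apply continuous_const|now apply separated_sum_continuous].
  - apply (continuous_mult (K := R_AbsRing) (fun z : R * R => q (snd z)));
      [now apply continuous_on_snd|now apply continuous_on_fst]. }
assert (Ef : forall k t, ex_derive (f k) t) by (eexists; apply Df).
assert (Eg : forall k t, ex_derive (g k) t) by (eexists; apply Dg).
assert (Es : forall t, ex_derive s t) by (eexists; apply Ds).
assert (Eq : forall t, ex_derive q t) by (eexists; apply Dq).
assert (Hmain := solves_problem_P_of_derivatives Phi F h u (W f g q s)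
  (W f' g q' s) (W f g' q s') (W f g'' q s'')).
(* The consistency condition: the slope at [0] is [c t^p + lambda q], which is [V] by the integral
   equation. *)
assert (HV : forall t, 0 < t -> W f g' q s' 0 t = V nu lambda mu eta p t).
{ intros t Ht; unfold W, f, g'; rewrite u0_boundary_slope, V_volterra by assumption.
  unfold q, s'; rewrite Rmult_0_r, cos_0; ring. }
destruct Hmain as [Hsol Hslope]; auto.
- intros x t Hx; unfold u, u_sol; rewrite HPhi by exact Hx.
  change (W f g q s x t) with (u0 eta p x t + q t * s x).
  unfold q, s, V_integral; ring.
- intros z; apply CW; auto.
  + intros k t; unfold f', dpow; auto_derive; trivial.
  + intros t; unfold q'; apply (ex_derive_minus (V := R_NormedModule)
      (fun t => nu * mu * V nu lambda mu eta p t)).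
    * apply (ex_derive_scal (V nu lambda mu eta p) (nu * mu)).
      eexists; now apply is_derive_V.
    * now apply (ex_derive_scal q (lambda ^ 2)).
- intros z; apply CW; auto; eexists; auto.
- intros z; apply CW; auto.
  + intros k x; unfold g'', ddpow; auto_derive; trivial.
  + intros x; unfold s'', s; auto_derive; trivial.
(* The heat sums cancel, and [q' s - q s''] reduces to [nu mu V sin (lambda x)], the source term. *)
- intros x t Hx Ht; rewrite HF, HV, HPhi by lra.
  unfold W, f', g, f, g''; rewrite heat_equation_sum.
  unfold q', s'', s; ring.
(* At [t = 0] the integral in [q] is over a point, so only [u0] remains. *)
- intros x Hx; rewrite Hh by lra.
  change (W f g q s x 0) with (u0 eta p x 0 + q 0 * s x).
  rewrite u0_initial; unfold q, V_integral; rewrite RInt_point.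
  change (@zero R_CompleteNormedModule) with 0; ring.
- intros t Ht; change (W f g q s 0 t) with (u0 eta p 0 t + q t * s 0).
  rewrite u0_boundary; unfold s; rewrite Rmult_0_r, sin_0; ring.
- split; [exact Hsol|].
  intros t Ht; rewrite <- HV by exact Ht; now apply Hslope.
Qed.
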